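(* Let $(G,N)$ be an equal order pair, and let $\mathbf{F}(G)$ denote the Fitting subgroup of $G$. Then either $N \subseteq \mathbf{F}(G)$ or $\mathbf{F}(G) \subseteq N$. Moreover, if $N$ is properly contained in $\mathbf{F}(G)$, then $\mathbf{F}(G)$ has prime-power order.
   Context: All groups are finite. If $G$ is a finite group and $N$ is a proper, nontrivial, normal subgroup of $G$, the pair $(G,N)$ is called an equal order pair if, for every $x \in G \setminus N$, all elements of the coset $xN$ have the same order as $x$. *)

(* Defs.v *)
From mathcomp Require Import all_boot all_fingroup all_solvable.
Set Implicit Arguments.
Unset Strict Implicit.
Unset Printing Implicit Defensive.

Local Open Scope group_scope.

Definition equal_order_pair (gT : finGroupType) (G N : {group gT}) : Prop :=
  [/\ N <| G, N \proper G, N :!=: 1 &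
      forall x y : gT, x \in G :\: N -> y \in x *: N -> #[y] = #[x]].

(* Main.v *)
Require Import Defs.
From mathcomp Require Import all_boot all_fingroup all_solvable.

(** If some p-core P of G is not contained in N, pick x in P outside N.  For n in N, the
    element x n has the order of x, so it is a p-element; modulo P it becomes n, so n is a
    p-element too.  Hence N is a p-group.  Since F(G) is generated by the p-cores, this
    gives the dichotomy, and N <> 1 leaves room for only one such p. *)

Local Open Scope group_scope.

Lemma equal_order_pair_pgroup (gT : finGroupType) (G N : {group gT}) (p : nat) :
  equal_order_pair G N -> ~~ ('O_p(G) \subset N) -> p.-group N.
Proof.
case=> /andP[sNG _] _ _ eqo /subsetPn[x Px notNx].
have Gx := subsetP (pcore_sub p G) x Px.
have nPG := normal_norm (pcore_normal p G).
(* ['O_p(G)] is a p-group, so it suffices to treat [N / 'O_p(G)]. There Cauchy gives an element of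
   prime order [q], the image of some [n] in [N], and [q = p] remains to be shown. *)
rewrite -(pquotient_pgroup (pcore_pgroup p G) (subset_trans sNG nPG)).
apply/pgroupP => q q_pr /(Cauchy q_pr)[_ /morphimP[n nPn Nn ->] ordn].
have pxn : p.-elt (x * n).
  rewrite /p_elt (eqo x) ?mem_lcoset ?mulKg ?inE ?notNx //.
  exact: mem_p_elt (pcore_pgroup p G) Px.
have nPx := subsetP nPG x Gx.
have: p.-elt (coset 'O_p(G) (x * n)) by apply: morph_p_elt pxn; apply: groupM.
by rewrite morphM //= (coset_id Px) mul1g /p_elt ordn pnatE.
Qed.

Lemma Fitting_not_sub (gT : finGroupType) (G N : {group gT}) :
  ~~ ('F(G) \subset N) -> exists2 p, prime p & ~~ ('O_p(G) \subset N).
Proof.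
rewrite FittingEgen gen_subG => /subsetPn[x /bigcupP[p pi_p Ox] notNx].
exists p; first by move: pi_p; rewrite mem_primes => /andP[].
by apply/subsetPn; exists x.
Qed.

(** For a prime [q] other than [p] dividing the order of ['F(G)], either ['O_q(G)] lies in the
    p-group [N], or [N] is also a q-group. Either way a nontrivial group would be trivial. *)
Lemma equal_order_pair_Fitting_pgroup (gT : finGroupType) (G N : {group gT}) (p : nat) :
  equal_order_pair G N -> p.-group N -> p.-group 'F(G).
Proof.
move=> eoGN pN; apply/pgroupP => q q_pr q_dv_F; apply: contraT => p'q.
have [_ _ ntN _] := eoGN.
(* The q-core of ['F(G)] is ['O_q(G)], and by nilpotency it is a Sylow subgroup of ['F(G)]. *)
have sylO := nilpotent_pcore_Hall q (Fitting_nil G).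
have ntO : 'O_q(G) != 1.
  rewrite -p_core_Fitting -cardG_gt1 (card_Hall sylO) p_part_gt1.
  by rewrite mem_primes q_pr cardG_gt0.
have trivI (H K : {group gT}) : q.-group H -> p.-group K -> H \subset K -> H :=: 1.
  move=> qH pK sHK; apply/eqP; rewrite -subG1 -(coprime_TIg (G := H) (H := K)) ?subsetI ?subxx //.
  by apply: pnat_coprime qH (pi_p'nat pK _).
have [sON | notsON] := boolP ('O_q(G) \subset N).
  by case/eqP: ntO; apply: trivI (pcore_pgroup q G) pN sON.
have qN := equal_order_pair_pgroup gT G N q eoGN notsON.
(* Here [trivI] is used with both groups equal to [N]. *)
by case/eqP: ntN; apply: trivI qN pN _.
Qed.

Theorem theoremA (gT : finGroupType) (G N : {group gT})
  (hGN : equal_order_pair G N) :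
  (N \subset 'F(G) \/ 'F(G) \subset N) /\
  (N \proper 'F(G) ->
     exists p k : nat, prime p /\ #|'F(G)| = (p ^ k)%N).
Proof.
have [sFN | notsFN] := boolP ('F(G) \subset N).
  by split; [right | rewrite properE sFN andbF].
have [p p_pr /(equal_order_pair_pgroup gT G N p hGN) pN] := Fitting_not_sub gT G N notsFN.
have pF := equal_order_pair_Fitting_pgroup gT G N p hGN pN.
have [nsNG _ _ _] := hGN; split.
  by left; apply: Fitting_max nsNG (pgroup_nil pN).
by have [k] := p_natP pF; exists p, k.
Qed.
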